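(* Let $\Pi=(\Sigma_{in},\Sigma_{out},\mathcal{P})$ be an LCL in normal form that is not mixing. Then $\Pi\in\mathsf{BOREL}$, i.e. for every standard Borel space $(X,\mathcal{B})$, every aperiodic Borel automorphism $S:X\to X$ and every Borel map $i:X\to\Sigma_{in}$ there is a Borel map $f:X\to\Sigma_{out}$ such that $\mathcal{P}((i(x),i(S(x))),(f(x),f(S(x))))=\texttt{true}$ for every $x\in X$.
   Context: An LCL in normal form is a triple $\Pi=(\Sigma_{in},\Sigma_{out},\mathcal{P})$ with $\Sigma_{in},\Sigma_{out}$ finite and $\mathcal{P}:\Sigma_{in}^2\times\Sigma_{out}^2\to\{\texttt{true},\texttt{false}\}$. A Borel automorphism $S$ is aperiodic if $S^n(x)=x$ implies $n=0$. Blocks and types: for $\sigma\in\Sigma_{in}$, a $\sigma$-block is a finite sequence $B=(\sigma_0,\sigma_1,\dots,\sigma_t)$ of elements of $\Sigma_{in}$, $t\ge1$, with $\sigma_0=\sigma_t=\sigma$. Its type $\texttt{type}(B)\subseteq\Sigma_{out}^2$ is the set of pairs $(\mathtt{a},\mathtt{b})$ for which there exist $c_0=\mathtt{a},c_1,\dots,c_t=\mathtt{b}$ in $\Sigma_{out}$ with $\mathcal{P}((\sigma_j,\sigma_{j+1}),(c_j,c_{j+1}))=\texttt{true}$ for all $0\le j<t$. Subpartitions: a subpartition of $\Sigma_{out}$ is a pair $(\Upsilon,\nabla)$ where $\nabla$ is an equivalence relation on some subset $\operatorname{dom}(\nabla)\subseteq\Sigma_{out}$ (possibly empty), and $\Upsilon=(\mathbb{P},\preceq)$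 where $\mathbb{P}$ is an equivalence relation on all of $\Sigma_{out}$ that is coarser than $\nabla$ on $\operatorname{dom}(\nabla)$ and $\preceq$ is a partial order on the set of $\mathbb{P}$-classes. Write $[\mathtt{a}]_\nabla$ for the $\nabla$-class and $\mathbb{P}(\mathtt{a})$ for the $\mathbb{P}$-class of $\mathtt{a}$. Permutation blocks: a block $B$ is a permutation block on $(\Upsilon,\nabla)$ if there is a permutation $\pi_B$ of the set of $\nabla$-classes such that for all $\mathtt{a},\mathtt{b}\in\Sigma_{out}$: (1) if $\pi_B([\mathtt{a}]_\nabla)=[\mathtt{b}]_\nabla$ then $\mathbb{P}(\mathtt{a})=\mathbb{P}(\mathtt{b})$; (2) $(\mathtt{a},\mathtt{b})\in\texttt{type}(B)$ implies $\mathbb{P}(\mathtt{a})\preceq\mathbb{P}(\mathtt{b})$; (3) if $\mathtt{a}\notin\operatorname{dom}(\nabla)$ and $(\mathtt{a},\mathtt{b})\in\texttt{type}(B)$ then $\mathbb{P}(\mathtt{a})\ne\mathbb{P}(\mathtt{b})$; (4) if $\mathtt{a},\mathtt{b}\in\operatorname{dom}(\nabla)$, $(\mathtt{a},\mathtt{b})\in\texttt{type}(B)$ and $\mathbb{P}(\mathtt{a})=\mathbb{P}(\mathtt{b})$ then $\pi_B([\mathtt{a}]_\nabla)=[\mathtt{b}]_\nabla$. Let $\Gamma_{\sigma,(\Upsilon,\nabla)}$ be the set of all permutations $\pi_B$ arising from permutation $\sigma$-blocks $B$ on $(\Upsilon,\nabla)$ (it is a group under composition, corresponding to concatenation of blocks),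 acting on the set of $\nabla$-classes. $\Pi$ is $(\sigma,\Upsilon,\nabla)$-mixing if this action has no fixed point, and $\Pi$ is mixing if it is $(\sigma,\Upsilon,\nabla)$-mixing for some $\sigma\in\Sigma_{in}$ and some subpartition $(\Upsilon,\nabla)$ of $\Sigma_{out}$. *)

(* Defs.v *)
From HB Require Import structures.
From mathcomp Require Import all_boot all_order all_algebra all_fingroup.
From mathcomp Require Import all_classical all_reals all_analysis.

Set Implicit Arguments.
Unset Strict Implicit.
Unset Printing Implicit Defensive.

(** * LCLs in normal form, blocks and types *)

Record lcl := LCL {
  Sigma_in : finType;
  Sigma_out : finType;
  rule : pred ((Sigma_in * Sigma_in) * (Sigma_out * Sigma_out))
}.

(** [B] lists [sigma_0, ..., sigma_t]; [t >= 1] reads [1 < size B]. *)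
Definition is_block (Pi : lcl) (s : Sigma_in Pi) (B : seq (Sigma_in Pi)) :=
  [&& 1 < size B, head s B == s & last s B == s].

(** For an [s]-block [B], which is nonempty, none of the default values of
    [head], [last] and [nth] below is ever returned. *)
Definition block_type (Pi : lcl) (s : Sigma_in Pi) (B : seq (Sigma_in Pi)) :
    {set Sigma_out Pi * Sigma_out Pi} :=
  [set ab | [exists c : (size B).-tuple (Sigma_out Pi),
    [&& head ab.1 c == ab.1, last ab.2 c == ab.2 &
        [forall j : 'I_(size B).-1,
          rule ((nth s B j, nth s B j.+1),
                (nth ab.1 c j, nth ab.1 c j.+1))]]]].

(** * Subpartitions *)

Definition eq_class (T : finType) (D : {set T}) (R : rel T) (a : T) : {set T} :=
  [set b in D | R a b].

(** [nabla] only matters on [nabla_dom], and [prec] only on the classes of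
    [part]. *)
Record subpartition (T : finType) := Subpartition {
  nabla_dom : {set T};
  nabla : rel T;
  part : rel T;
  prec : rel {set T};
  nabla_equiv : {in nabla_dom & &, equivalence_rel nabla};
  part_equiv : equivalence_rel part;
  nabla_part : {in nabla_dom &, forall a b, nabla a b -> part a b};
  prec_refl : {in equivalence_partition part [set: T], reflexive prec};
  prec_anti : {in equivalence_partition part [set: T] &, antisymmetric prec};
  prec_trans : {in equivalence_partition part [set: T] & &, transitive prec}
}.

Section SubpartitionClasses.
Variables (T : finType) (U : subpartition T).

Definition nabla_class (a : T) : {set T} :=
  eq_class (nabla_dom U) (nabla U) a.

Definition nabla_classes : {set {set T}} :=
  equivalence_partition (nabla U) (nabla_dom U).

Definition part_class (a : T) : {set T} := eq_class [set: T] (part U) a.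

End SubpartitionClasses.

(** * Permutation blocks and mixing *)

(** A permutation of the set of [nabla]-classes is represented by a permutation
    of [{set Sigma_out}] that moves nothing outside that set. *)
Record block_perm (Pi : lcl) (U : subpartition (Sigma_out Pi))
    (s : Sigma_in Pi) (B : seq (Sigma_in Pi))
    (pi : {perm {set Sigma_out Pi}}) : Prop := BlockPerm {
  block_perm_on : perm_on (nabla_classes U) pi;
  block_perm_part : forall a b, a \in nabla_dom U -> b \in nabla_dom U ->
    pi (nabla_class U a) = nabla_class U b -> part_class U a = part_class U b;
  block_perm_prec : forall a b, (a, b) \in block_type s B ->
    prec U (part_class U a) (part_class U b);
  block_perm_strict : forall a b, a \notin nabla_dom U ->
    (a, b) \in block_type s B -> part_class U a <> part_class U b;
  block_perm_act : forall a b, a \in nabla_dom U -> b \in nabla_dom U ->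
    (a, b) \in block_type s B -> part_class U a = part_class U b ->
    pi (nabla_class U a) = nabla_class U b
}.

Definition Gamma (Pi : lcl) (s : Sigma_in Pi) (U : subpartition (Sigma_out Pi)) :
    {set {perm {set Sigma_out Pi}}} :=
  [set pi | `[< exists2 B, is_block s B & block_perm U s B pi >]].

(** Concatenating blocks shows that [Gamma s U] is closed under products, so it
    is a group as soon as it is nonempty. Nonemptiness has to be required: if no
    permutation block exists there is no group to act, whereas the absence of
    fixed points alone would hold trivially for [nabla_dom U = set0]. *)
Definition mixing_at (Pi : lcl) (s : Sigma_in Pi)
    (U : subpartition (Sigma_out Pi)) : Prop :=
  Gamma s U != finset.set0 /\ 'Fix_(nabla_classes U | 'P)(Gamma s U)%g = finset.set0.

Definition mixing (Pi : lcl) : Prop :=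
  exists (s : Sigma_in Pi) (U : subpartition (Sigma_out Pi)), mixing_at s U.

(** * Standard Borel spaces and the class BOREL *)

Local Open Scope classical_set_scope.

(** Measurable spaces are given as a type with a family of subsets because the
    [measurableType]s of the library are inhabited, and the empty space is
    standard Borel. For the same reason completeness is spelled out: the
    structure [completeType] requires a point. *)

Definition polish (R : realType) (Y : metricType R) : Prop :=
  (forall F : set_system Y, ProperFilter F -> cauchy F ->
     exists y : Y, F --> y) /\
  (exists2 D : set Y, countable D & dense D).

(** [h] is an isomorphism onto the Borel space of [Y]; as [h] is bijective,
    every subset of [X] is of the form [h @^-1` A], so [B] is determined and is
    a sigma-algebra. *)
Definition standard_borel (R : realType) (X : Type) (B : set (set X)) : Prop :=
  exists Y : metricType R, polish Y /\
    exists2 h : X -> Y, bijective h &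
      forall A : set Y, B (h @^-1` A) <-> <<s open >> A.

Definition borel_automorphism (X : Type) (B : set (set X)) (S : X -> X) : Prop :=
  exists T : X -> X, [/\ cancel S T, cancel T S,
    forall A, B A -> B (S @^-1` A) & forall A, B A -> B (T @^-1` A)].

(** Natural exponents suffice: [S] is bijective, so [S^(-n) x = x] if and only
    if [S^n x = x]. *)
Definition aperiodic (X : Type) (S : X -> X) : Prop :=
  forall (n : nat) (x : X), iter n S x = x -> n = 0.

Definition borel_labeling (X : Type) (B : set (set X)) (L : finType)
    (f : X -> L) : Prop :=
  forall A : set L, B (f @^-1` A).

Definition BOREL (R : realType) (Pi : lcl) : Prop :=
  forall (X : Type) (B : set (set X)), standard_borel R B ->
  forall S : X -> X, borel_automorphism B S -> aperiodic S ->
  forall i : X -> Sigma_in Pi, borel_labeling B i ->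
  exists2 f : X -> Sigma_out Pi, borel_labeling B f &
    forall x, rule ((i x, i (S x)), (f x, f (S x))).

(* Main.v *)
Require Import Defs.
From mathcomp Require Import all_boot all_order all_algebra all_fingroup.
From mathcomp Require Import all_classical all_reals all_analysis.
(* Restores the finite-set names shadowed by those of [classical_sets]. *)
From mathcomp Require Import fintype finset.

Set Implicit Arguments.
Unset Strict Implicit.
Unset Printing Implicit Defensive.

Import Order.TTheory GRing.Theory Num.Theory.
Import numFieldNormedType.Exports.

(** Types of blocks compose as binary relations on [Sigma_out]. The right ideal
    of the type of [x, ..., S^n x] decreases with [n], hence is eventually
    constant, and so is the left ideal of the type of [S^(-n) x, ..., x]. Sorting
    points by their letter, these two limits and a time of stabilization, and
    separating returns by countably many Borel sets, covers the space by countably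
    many Borel sets of markers, within each of which return times exceed the
    stabilization time. On an orbit visiting such a set recurrently in both
    directions, the types between markers, and their products, lie in one Green
    H-class, which is therefore a group of relations. A group of relations with
    identity [e] permutes the classes of [{a | (a, a) \in e}], and its blocks are
    permutation blocks for the subpartition given by these classes and by the
    preorder that is the union of the group. As [Pi] is not mixing there is a fixed
    class, so some [a] satisfies [(a, a) \in h] for every [h] of the group: label
    all markers by [a] and fill in the gaps. All remaining orbits have a first or
    a last visit to some set of markers, hence a Borel selector, and are labelled
    by compactness, since in a non-mixing LCL every word has a labeling. *)

(** * Green classes that are groups *)

Section Green.
Variables (T : finType) (e0 : T) (op : T -> T -> T).
Hypotheses (opA : associative op) (op0x : left_id e0 op) (opx0 : right_id e0 op).
Implicit Types (g h u : T) (C : {set T}).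

Definition right_ideal h : {set T} := [set op h u | u : T].
Definition left_ideal h : {set T} := [set op u h | u : T].

Lemma right_idealP h h' : right_ideal h = right_ideal h' -> exists u, h' = op h u.
Proof.
move=> E; have : h' \in right_ideal h.
  by rewrite E; apply/imsetP; exists e0; rewrite ?opx0.
by case/imsetP=> u _ ->; exists u.
Qed.

Lemma left_idealP h h' : left_ideal h = left_ideal h' -> exists u, h' = op u h.
Proof.
move=> E; have : h' \in left_ideal h.
  by rewrite E; apply/imsetP; exists e0; rewrite ?op0x.
by case/imsetP=> u _ ->; exists u.
Qed.

Lemma right_idealS h u : right_ideal (op h u) \subset right_ideal h.
Proof.
by apply/subsetP=> _ /imsetP[v _ ->]; rewrite -opA; apply: imset_f.
Qed.

Lemma left_idealS h u : left_ideal (op u h) \subset left_ideal h.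
Proof.
by apply/subsetP=> _ /imsetP[v _ ->]; rewrite opA; apply: imset_f.
Qed.

Lemma right_ideal_mul h u v :
  right_ideal h = right_ideal (op h (op u v)) -> right_ideal (op h u) = right_ideal h.
Proof.
move=> E; apply/eqP; rewrite eqEsubset right_idealS E opA.
exact: right_idealS.
Qed.

Lemma left_ideal_mul h u v :
  left_ideal h = left_ideal (op (op v u) h) -> left_ideal (op u h) = left_ideal h.
Proof.
move=> E; apply/eqP; rewrite eqEsubset left_idealS E -opA.
exact: left_idealS.
Qed.

(** Green's H-class with the given ideals, cut down to [P]; the ideals are those of the whole
    monoid. *)
Definition green_class (P : pred T) (rho lam : {set T}) : {set T} :=
  [set h | [&& P h, right_ideal h == rho & left_ideal h == lam]].

Section Group.
Variables (P : pred T) (rho lam : {set T}).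
Hypothesis PM : forall g h, P g -> P h -> P (op g h).
Let H := green_class P rho lam.
Variables h1 h2 : T.
Hypotheses (h1H : h1 \in H) (h2H : h2 \in H) (h12H : op h1 h2 \in H).

Lemma green_classR g h : g \in H -> h \in H -> exists u, h = op g u.
Proof.
rewrite !inE => /and3P[_ /eqP gr _] /and3P[_ /eqP hr _].
by apply: right_idealP; rewrite gr hr.
Qed.

Lemma green_classL g h : g \in H -> h \in H -> exists u, h = op u g.
Proof.
rewrite !inE => /and3P[_ _ /eqP gr] /and3P[_ _ /eqP hr].
by apply: left_idealP; rewrite gr hr.
Qed.

(** Green's argument: write [g] as a left multiple of [h1] and [h] as a right multiple of [h2].
    Since [op h1 h2] can be multiplied back to [h1] and to [h2], [op g h] can be multiplied back to
    [g] and to [h], which determines both of its ideals. *)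
Lemma green_classM g h : g \in H -> h \in H -> op g h \in H.
Proof.
move=> gH hH.
have [c gE] := green_classL h1H gH.
have [d hE] := green_classR h2H hH.
have [w h2E] := green_classR hH h2H.
have [x h1E] := green_classR h12H h1H.
have [w' h1E'] := green_classL gH h1H.
have [x' h2E'] := green_classL h12H h2H.
have gE2 : op (op g h) (op w x) = g.
  by rewrite {2}gE {1}h1E h2E {1}gE !opA.
have hE2 : op (op x' w') (op g h) = h.
  by rewrite {2}hE {1}h2E' h1E' {1}hE !opA.
move: (gH) (hH); rewrite !inE => /and3P[Pg /eqP gr _] /and3P[Ph _ /eqP hl].
apply/and3P; split; first exact: PM.
- apply/eqP; rewrite -gr; apply: (right_ideal_mul (v := op w x)).
  by rewrite [op g _]opA gE2.
- apply/eqP; rewrite -hl; apply: (left_ideal_mul (v := op x' w')).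
  by rewrite -[op _ h]opA hE2.
Qed.

Lemma green_class_iterM g h k : g \in H -> h \in H -> iter k (op g) h \in H.
Proof. by move=> gH hH; elim: k => //= k; apply: green_classM. Qed.

Lemma iter_opA g h u k : op (iter k (op g) h) u = iter k (op g) (op h u).
Proof. by elim: k => //= k <-; rewrite opA. Qed.

(* Left multiplication by [g] permutes [H]; its order gives the identity. *)
Lemma green_class_period g : g \in H -> exists k, forall h, h \in H ->
  op (iter k (op g) g) h = h.
Proof.
move=> gH; pose f h := if h \in H then op g h else h.
have f_inj : injective f.
  (* As [g] equals [op y (op g g)], left multiplication by [y] undoes that by [g] on all right
     multiples of [g], hence on [H]. *)
  have [y yE] := green_classL (green_classM gH gH) gH.
  have yK h : h \in H -> op y (op g h) = h.
    by case/(green_classR gH) => w ->; rewrite {3}yE !opA.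
  move=> a b; rewrite /f; case: ifP => [aH|aH]; case: ifP => [bH|bH] //.
  - by move=> E; rewrite -(yK a aH) E yK.
  - by move=> E; rewrite -E (green_classM gH aH) in bH.
  - by move=> E; rewrite E (green_classM gH bH) in aH.
pose s := perm f_inj; have := order_gt0 s; case E: #[s]%g => [//|k] _.
exists k => h hH; rewrite iter_opA -iterSr.
have : (s ^+ k.+1)%g h = h by rewrite -E expg_order perm1.
rewrite permX => {2}<-; elim: k.+1 => //= n IHn.
by rewrite permE /f -IHn green_class_iterM.
Qed.

(** A power of [h1] is the identity. Each other element has a power that is an identity too, hence
    the same one. *)
Lemma green_class_group : exists2 e, e \in H &
  (forall h, h \in H -> op e h = h /\ op h e = h) /\
  (forall h, h \in H -> exists k, iter k (op h) h = e).
Proof.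
have id2 g k : g \in H -> (forall h, h \in H -> op (iter k (op g) g) h = h) ->
    forall h, h \in H -> op h (iter k (op g) g) = h.
  move=> gH E h hH; have eH := green_class_iterM k gH gH.
  by have [y ->] := green_classL eH hH; rewrite -opA E.
have [k Ek] := green_class_period h1H.
exists (iter k (op h1) h1); first exact: green_class_iterM.
split=> h hH; first by split; [exact: Ek|exact: id2].
have [l El] := green_class_period hH; exists l.
by rewrite -{1}(Ek (iter l (op h) h)) ?(id2 h) ?green_class_iterM.
Qed.

End Group.
End Green.

(** * The monoid of binary relations on a finite set *)

Section Relations.
Variable V : finType.
Implicit Types (r t u : {set V * V}) (a b c : V).

Definition rcomp r t : {set V * V} :=
  [set ab | [exists c, ((ab.1, c) \in r) && ((c, ab.2) \in t)]].

Definition rid : {set V * V} := [set ab | ab.1 == ab.2].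

Lemma rcompP r t a b :
  reflect (exists2 c, (a, c) \in r & (c, b) \in t) ((a, b) \in rcomp r t).
Proof. by rewrite inE; apply: exists_inP. Qed.

Lemma rcompI r t a b c : (a, b) \in r -> (b, c) \in t -> (a, c) \in rcomp r t.
Proof. by move=> ab bc; apply/rcompP; exists b. Qed.

Lemma rcompA : associative rcomp.
Proof.
move=> r t u; apply/setP=> -[a b]; apply/rcompP/rcompP.
  by case=> c ac /rcompP[d cd db]; exists d => //; apply: rcompI cd.
by case=> c /rcompP[d ad dc] cb; exists d => //; apply: rcompI cb.
Qed.

Lemma rcomp0x : left_id rid rcomp.
Proof.
move=> r; apply/setP=> -[a b]; apply/rcompP/idP; last by exists a; rewrite ?inE.
by case=> c; rewrite inE => /eqP /= ->.
Qed.

Lemma rcompx0 : right_id rid rcomp.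
Proof.
move=> r; apply/setP=> -[a b]; apply/rcompP/idP; last by exists b; rewrite ?inE.
by case=> c ac; rewrite inE => /eqP /= <-.
Qed.

End Relations.

(** * Groups of relations *)

Section GroupOfRelations.
Variables (V : finType) (H : {set {set V * V}}) (e : {set V * V}).
Hypotheses (eH : e \in H) (HM : forall r t, r \in H -> t \in H -> rcomp r t \in H).
Hypothesis e_id : forall r, r \in H -> rcomp e r = r /\ rcomp r e = r.
Hypothesis He : forall r, r \in H -> exists k, iter k (rcomp r) r = e.
Implicit Types (r t : {set V * V}) (a b c : V).

Let er r : r \in H -> rcomp e r = r. Proof. by case/e_id. Qed.
Let re r : r \in H -> rcomp r e = r. Proof. by case/e_id. Qed.

Let iterH k r t : r \in H -> t \in H -> iter k (rcomp r) t \in H.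
Proof. by move=> rH tH; elim: k => //= k; apply: HM. Qed.

Let iter_rcomp k r t u : rcomp (iter k (rcomp r) t) u = iter k (rcomp r) (rcomp t u).
Proof. by elim: k => //= k <-; rewrite rcompA. Qed.

Let iter_rcompC k r t : rcomp t r = rcomp r t ->
  rcomp (iter k (rcomp r) t) r = rcomp r (iter k (rcomp r) t).
Proof. by move=> tr; rewrite iter_rcomp tr -iterSr. Qed.

Lemma relation_loop_iter k r t a :
  (a, a) \in r -> (a, a) \in t -> (a, a) \in iter k (rcomp r) t.
Proof. by move=> ar at_; elim: k => //= k; apply: rcompI. Qed.

Lemma relation_loop r a : r \in H -> (a, a) \in r -> (a, a) \in e.
Proof. by move=> /He[k <-] ar; apply: relation_loop_iter. Qed.

(** The inverse is a power of [r], so it inherits the loops of [r]. *)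
Lemma relation_inverse r : r \in H -> exists2 r', r' \in H &
  [/\ rcomp r r' = e, rcomp r' r = e & forall a, (a, a) \in r -> (a, a) \in r'].
Proof.
move=> rH; have [k Ek] := He rH; exists (iter k (rcomp r) e); first exact: iterH.
have E : rcomp r (iter k (rcomp r) e) = e.
  by rewrite -iterS iterSr re.
split=> //; first by rewrite iter_rcompC // er // re.
by move=> a ar; apply: relation_loop_iter => //; apply: relation_loop ar.
Qed.

Lemma rcomp_trans r t a b c : (a, b) \in r -> (b, c) \in t -> rcomp r t = e ->
  (a, c) \in e.
Proof. by move=> ab bc <-; apply: rcompI bc. Qed.

Lemma e_trans a b c : (a, b) \in e -> (b, c) \in e -> (a, c) \in e.
Proof. by move=> ab bc; rewrite -(er eH); apply: rcompI bc. Qed.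

(** The union of the group is transitive, but reflexive only on [loops]; adding the diagonal gives a
    preorder on all labels. *)
Definition orbit_le : rel V := fun a b => (a == b) || [exists r in H, (a, b) \in r].
Definition orbit_eq : rel V := fun a b => orbit_le a b && orbit_le b a.
Definition class_le : rel {set V} :=
  fun A B => [exists a in A, exists b in B, orbit_le a b].
Definition loops : {set V} := [set a | (a, a) \in e].
(** On [loops] the idempotent [e] is a preorder; this is its symmetric part. *)
Definition loop_eq : rel V := fun a b => ((a, b) \in e) && ((b, a) \in e).

Lemma orbit_leI r a b : r \in H -> (a, b) \in r -> orbit_le a b.
Proof. by move=> rH ab; apply/orP; right; apply/existsP; exists r; rewrite rH. Qed.

Lemma orbit_le_refl a : orbit_le a a. Proof. by rewrite /orbit_le eqxx. Qed.

Lemma orbit_le_trans : transitive orbit_le.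
Proof.
move=> b a c /orP[/eqP-> //|/exists_inP[r rH ab]] /orP[/eqP <-|/exists_inP[t tH bc]].
  exact: orbit_leI ab.
by apply: (orbit_leI (HM rH tH)); apply: rcompI bc.
Qed.

Lemma loop_eq_equiv : {in loops & &, equivalence_rel loop_eq}.
Proof.
move=> a b c; rewrite !inE => aD bD cD; split; first by rewrite /loop_eq cD.
move=> /andP[ab ba]; apply/andP/andP => -[x y]; split; by
  [apply: e_trans x|apply: e_trans y _|apply: e_trans x|apply: e_trans y _].
Qed.

Lemma orbit_eq_equiv : equivalence_rel orbit_eq.
Proof.
move=> a b c; split; first by rewrite /orbit_eq orbit_le_refl.
move=> /andP[ab ba]; apply/andP/andP => -[x y]; split; by
  [apply: orbit_le_trans x|apply: orbit_le_trans y _|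
   apply: orbit_le_trans x|apply: orbit_le_trans y _].
Qed.

Lemma loop_eq_orbit : {in loops &, forall a b, loop_eq a b -> orbit_eq a b}.
Proof.
move=> a b _ _ /andP[ab ba].
by apply/andP; split; [apply: orbit_leI ab|apply: orbit_leI ba].
Qed.

Definition orbit_class a : {set V} := [set b in [set: V] | orbit_eq a b].

Lemma orbit_classP A : A \in equivalence_partition orbit_eq [set: V] ->
  exists a, A = orbit_class a.
Proof. by case/imsetP=> a _ ->; exists a. Qed.

Lemma class_leE a b : class_le (orbit_class a) (orbit_class b) = orbit_le a b.
Proof.
apply/idP/idP=> [|ab].
  case/exists_inP=> a'; rewrite !inE /= => /andP[aa' _].
  case/exists_inP=> b'; rewrite !inE /= => /andP[_ b'b] a'b'.
  exact: orbit_le_trans (orbit_le_trans aa' a'b') b'b.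
apply/exists_inP; exists a; first by rewrite !inE /orbit_eq orbit_le_refl.
by apply/exists_inP; exists b => //; rewrite !inE /orbit_eq orbit_le_refl.
Qed.

Lemma orbit_class_eqP a b : reflect (orbit_class a = orbit_class b) (orbit_eq a b).
Proof.
apply: (iffP idP) => [ab|E].
  apply/setP=> c; rewrite !inE /=.
  by have [_ /(_ ab)] := orbit_eq_equiv a b c.
have : b \in orbit_class b by rewrite !inE /orbit_eq orbit_le_refl.
by rewrite -E !inE.
Qed.

Lemma class_le_refl :
  {in equivalence_partition orbit_eq [set: V], reflexive class_le}.
Proof. by move=> _ /orbit_classP[a ->]; rewrite class_leE orbit_le_refl. Qed.

Lemma class_le_anti :
  {in equivalence_partition orbit_eq [set: V] &, antisymmetric class_le}.
Proof.
move=> _ _ /orbit_classP[a ->] /orbit_classP[b ->]; rewrite !class_leE.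
by move=> ab; apply/orbit_class_eqP.
Qed.

Lemma class_le_trans :
  {in equivalence_partition orbit_eq [set: V] & &, transitive class_le}.
Proof.
move=> _ _ _ /orbit_classP[a ->] /orbit_classP[b ->] /orbit_classP[c ->].
by rewrite !class_leE; apply: orbit_le_trans.
Qed.

Definition group_subpartition : subpartition V :=
  Subpartition loop_eq_equiv orbit_eq_equiv loop_eq_orbit
    class_le_refl class_le_anti class_le_trans.
Local Notation U := group_subpartition.

Lemma loop_class_eqP a b : a \in loops -> b \in loops ->
  reflect (nabla_class U a = nabla_class U b) (loop_eq a b).
Proof.
move=> aD bD; apply: (iffP idP) => [ab|E].
  apply/setP=> c; rewrite !inE /=; case cD: ((c, c) \in e) => //=.
  by have [_ /(_ ab)] := loop_eq_equiv aD bD (etrans (in_set _ c) cD).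
have : b \in nabla_class U b by move: bD; rewrite !inE /= /loop_eq => ->.
by rewrite -E inE => /andP[].
Qed.

Section Perm.
Variables r r' : {set V * V}.
Hypotheses (rH : r \in H) (rH' : r' \in H) (rr' : rcomp r r' = e) (r'r : rcomp r' r = e).

(** The [r]-successors of a class may meet several classes; the way back through the inverse [r']
    singles out one of them. *)
Definition class_image (A : {set V}) : {set V} :=
  if A \in nabla_classes U then
    [set b | [exists a in A, ((a, b) \in r) && ((b, a) \in r')]]
  else A.

Lemma class_image_class a b : a \in loops -> (a, b) \in r -> (b, a) \in r' ->
  b \in loops /\ class_image (nabla_class U a) = nabla_class U b.
Proof.
move=> aD ab ba; have bD : b \in loops by rewrite inE (rcomp_trans ba ab).
split=> //; rewrite /class_image.
have -> : nabla_class U a \in nabla_classes U by apply/imsetP; exists a.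
apply/setP=> c; rewrite !inE /=; apply/exists_inP/and3P => [[a']|[cD bc cb]].
  rewrite !inE /= => /and3P[_ aa' a'a] /andP[a'c ca'].
  split; first exact: (rcomp_trans ca' a'c).
    by apply: rcomp_trans ba _ r'r; rewrite -(er rH); apply: rcompI a'c.
  by apply: rcomp_trans ca' _ r'r; rewrite -(er rH); apply: rcompI ab.
exists a; first by move: aD; rewrite !inE /= /loop_eq => ->.
apply/andP; split.
  by rewrite -(re rH); apply: rcompI bc.
by rewrite -(er rH'); apply: rcompI ba.
Qed.

Lemma class_image_ex a : a \in loops -> exists2 b, (a, b) \in r & (b, a) \in r'.
Proof. by rewrite inE -rr' => /rcompP[b ab ba]; exists b. Qed.

End Perm.

Lemma class_imageK r r' : r \in H -> r' \in H -> rcomp r r' = e -> rcomp r' r = e ->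
  cancel (class_image r r') (class_image r' r).
Proof.
move=> rH rH' rr' r'r A; case AD: (A \in nabla_classes U); last first.
  by rewrite {2}/class_image AD /class_image AD.
case/imsetP: AD => a aD ->.
have [b ab ba] := class_image_ex rr' aD.
have [bD ->] := class_image_class rH rH' r'r aD ab ba.
by have [_ ->] := class_image_class rH' rH rr' bD ba ab.
Qed.

(** The second clause realizes the permutation by pairs of [r], so that a fixed class will yield a
    loop in [r]. *)
Lemma relation_perm r : r \in H -> exists pi : {perm {set V}},
  [/\ perm_on (nabla_classes U) pi,
   forall a, a \in loops -> exists2 b, (a, b) \in r & b \in loops /\
     pi (nabla_class U a) = nabla_class U b,
   forall a b, a \in loops -> b \in loops ->
     pi (nabla_class U a) = nabla_class U b -> orbit_eq a b &
   forall a b, a \in loops -> b \in loops -> (a, b) \in r -> orbit_eq a b ->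
     pi (nabla_class U a) = nabla_class U b].
Proof.
move=> rH; have [r' rH' [rr' r'r _]] := relation_inverse rH.
exists (perm (can_inj (class_imageK rH rH' rr' r'r))).
have img a : a \in loops -> exists2 b, ((a, b) \in r) && ((b, a) \in r') &
    b \in loops /\ class_image r r' (nabla_class U a) = nabla_class U b.
  move=> aD; have [b ab ba] := class_image_ex rr' aD.
  by exists b; [rewrite ab|apply: class_image_class].
split.
- by apply/subsetP=> A; rewrite !inE permE /class_image; case: ifP; rewrite ?eqxx.
- move=> a /img[b /andP[ab _] [bD E]]; exists b => //.
  by rewrite permE.
- move=> a b aD bD; rewrite permE; have [c /andP[ac ca] [cD ->]] := img a aD.
  move=> /(loop_class_eqP cD bD)/(loop_eq_orbit cD bD) cb.
  have [_ ->] // := orbit_eq_equiv a c b.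
  by apply/andP; split; [apply: orbit_leI ac|apply: orbit_leI ca].
move=> a b aD bD ab /andP[_ /orP ba]; rewrite permE.
have [r2 r2H br2] : exists2 r2, r2 \in H & (b, a) \in r2.
  case: ba => [/eqP->|/exists_inP//]; exists e => //.
  by rewrite inE in aD.
(* [r2] leads back from [b] to [a]; correcting it by the loop of [r r2] at [a]
   yields the inverse [r']. *)
have [g' g'H [g'1 _ ag']] := relation_inverse (HM rH r2H).
have r'E : r' = rcomp r2 g'.
  by rewrite -(re rH') -g'1 -rcompA [rcomp r' _]rcompA r'r rcompA er.
apply: (proj2 (class_image_class rH rH' r'r aD ab _)).
by rewrite r'E; apply: (rcompI br2); apply/ag'/(rcompI ab br2).
Qed.

End GroupOfRelations.

Lemma least_nat (P : nat -> Prop) : (exists n, P n) ->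
  exists n, P n /\ forall j, j < n -> ~ P j.
Proof.
move=> [k Pk].
have [n /asboolP Pn minn] :=
  ex_minnP (ex_intro (fun n => `[< P n >]) k (introT (asboolP _) Pk)).
by exists n; split=> // j jn /asboolP /minn; rewrite leqNgt jn.
Qed.

(** * Types of words *)

Section Words.
Variable Pi : lcl.
Implicit Types (s : Sigma_in Pi) (w : seq (Sigma_in Pi)) (a b c : Sigma_out Pi).

Definition edge_rel s (t : Sigma_in Pi) : {set Sigma_out Pi * Sigma_out Pi} :=
  [set ab | rule ((s, t), ab)].

(** The type of the word [s :: w]. With the first letter kept apart, concatenation becomes
    composition, and a single letter gives the identity. *)
Fixpoint word_rel s w : {set Sigma_out Pi * Sigma_out Pi} :=
  if w is t :: w' then rcomp (edge_rel s t) (word_rel t w') else rid _.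

Lemma word_rel_cat s w1 w2 :
  word_rel s (w1 ++ w2) = rcomp (word_rel s w1) (word_rel (last s w1) w2).
Proof.
by elim: w1 s => [|t w1 IH] s /=; rewrite ?rcomp0x // IH rcompA.
Qed.

(** The default values are free parameters for the sake of the induction: in [block_type] they
    include the first label, which changes when the first letter is removed. *)
Lemma word_relE s0 d1 d2 d s w a b :
  [exists c : (size (s :: w)).-tuple (Sigma_out Pi),
    [&& head d1 c == a, last d2 c == b &
        [forall j : 'I_(size (s :: w)).-1,
          rule ((nth s0 (s :: w) j, nth s0 (s :: w) j.+1),
                (nth d c j, nth d c j.+1))]]] = ((a, b) \in word_rel s w).
Proof.
elim: w s a => [|t w IH] s a /=.
  apply/existsP/idP => [[c /and3P[/eqP /= ca /eqP cb _]]|].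
    by rewrite inE /=; case: c ca cb => -[|c [|]] //= _ -> ->.
  rewrite inE /= => /eqP <-; exists [tuple a]; rewrite /= !eqxx /=.
  by apply/forallP=> -[].
apply/existsP/rcompP => [[c]|[a']].
  case: c => -[|c0 [|a' c]] // szc /and3P[/eqP /= -> cb /forallP /= Hc].
  exists a'; first by have := Hc ord0; rewrite inE.
  rewrite -IH; have szc' : size (a' :: c) == size (t :: w) by [].
  apply/existsP; exists (Tuple szc'); rewrite /= eqxx cb /=.
  by apply/forallP=> j; apply: (Hc (lift ord0 j)).
rewrite inE -IH => E /existsP[c /and3P[ca cb /forallP Hc]].
case: c ca cb Hc => -[|c0 c] // szc ca cb Hc.
have szc' : size (a :: c0 :: c) == size (s :: t :: w) by [].
exists (Tuple szc'); rewrite /= eqxx (cb : last c0 c == b) /=.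
apply/forallP=> -[[|j] jlt] /=; first by move: ca => /eqP /= ->.
exact: (Hc (Ordinal (jlt : j < (size (t :: w)).-1))).
Qed.

Lemma block_type_word s0 s w : block_type s0 (s :: w) = word_rel s w.
Proof. by apply/setP=> -[a b]; rewrite inE; apply: word_relE. Qed.

Lemma block_word s w : is_block s (s :: w) = (0 < size w) && (last s w == s).
Proof. by rewrite /is_block /= eqxx. Qed.

Definition block_rel s : pred {set Sigma_out Pi * Sigma_out Pi} :=
  fun r => `[< exists w, [/\ 0 < size w, last s w = s & word_rel s w = r] >].

Lemma block_rel_comp s r1 r2 :
  block_rel s r1 -> block_rel s r2 -> block_rel s (rcomp r1 r2).
Proof.
move=> /asboolP[w1 [w10 l1 <-]] /asboolP[w2 [w20 l2 <-]]; apply/asboolP.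
exists (w1 ++ w2); rewrite size_cat addn_gt0 w10 last_cat l1; split=> //.
by rewrite word_rel_cat l1.
Qed.

(* On the subpartition with empty domain, every block of empty type is a
   permutation block, and the action has no classes to fix. *)
Lemma word_rel_neq0 s w : ~ mixing Pi -> word_rel s w != finset.set0.
Proof.
move=> nmix; apply/negP => /eqP w0; apply: nmix.
pose D : {set Sigma_out Pi} := finset.set0.
pose R : rel (Sigma_out Pi) := fun _ _ => true.
have one (A : {set Sigma_out Pi}) : A \in equivalence_partition R [set: Sigma_out Pi] ->
    A = [set: Sigma_out Pi].
  by case/imsetP => a _ ->; apply/setP=> b; rewrite !inE.
have h1 : {in D & &, equivalence_rel R} by [].
have h2 : equivalence_rel R by [].
have h3 : {in D &, forall a b, R a b -> R a b} by [].
have h4 : {in equivalence_partition R [set: Sigma_out Pi],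
  reflexive (fun _ _ : {set Sigma_out Pi} => true)} by [].
have h5 : {in equivalence_partition R [set: Sigma_out Pi] &,
  antisymmetric (fun _ _ : {set Sigma_out Pi} => true)}.
  by move=> A B /one -> /one ->.
have h6 : {in equivalence_partition R [set: Sigma_out Pi] & &,
  transitive (fun _ _ : {set Sigma_out Pi} => true)} by [].
pose U := Subpartition h1 h2 h3 h4 h5 h6.
have cl0 : nabla_classes U = finset.set0.
  by rewrite /nabla_classes /equivalence_partition imset0.
exists s, U; split; last by rewrite cl0 set0I.
apply/set0Pn; exists 1%g; rewrite inE; apply/asboolP.
(* Appending [s] closes the word into an [s]-block, and its type stays empty. *)
exists (s :: rcons w s); first by rewrite block_word size_rcons last_rcons eqxx.
have ty0 : block_type s (s :: rcons w s) = finset.set0.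
  rewrite block_type_word -cats1 word_rel_cat w0; apply/setP=> -[a b].
  by rewrite [RHS]inE; apply/rcompP => -[c]; rewrite inE.
split=> [|a b|a b|a b _|a b]; rewrite ?ty0 ?inE //.
exact: perm_on1.
Qed.

(** The memberships make [H] a group, all of whose permutations lie in [Gamma]. If the class of [a]
    is fixed, each [h] has a pair from [a] to some [b] in that class; composing with the pair from
    [b] to [a] in the identity gives a loop in [h]. *)
Lemma nonmixing_common_loop s (rho lam : {set {set Sigma_out Pi * Sigma_out Pi}}) h1 h2 :
  ~ mixing Pi ->
  let H := green_class (@rcomp _) (block_rel s) rho lam in
  h1 \in H -> h2 \in H -> rcomp h1 h2 \in H ->
  exists a, forall h, h \in H -> (a, a) \in h.
Proof.
move=> nmix H h1H h2H h12H.
have HM : forall r t, r \in H -> t \in H -> rcomp r t \in H.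
  move=> r t; apply: (green_classM (@rcompA _) (@rcomp0x _) (@rcompx0 _) _ h1H h2H h12H).
  exact: block_rel_comp.
have [e eH [e_id He]] := green_class_group (@rcompA _) (@rcomp0x _) (@rcompx0 _)
  (@block_rel_comp s) h1H h2H h12H.
pose U := group_subpartition eH HM e_id.
have GammaH r : r \in H -> exists2 pi, pi \in Gamma s U &
    forall a, a \in loops e -> exists2 b, (a, b) \in r & b \in loops e /\
      pi (nabla_class U a) = nabla_class U b.
  move=> rH; have [pi [pi_on pi_ex pi_part pi_act]] := relation_perm eH HM e_id He rH.
  exists pi => //; rewrite inE; apply/asboolP.
  have : block_rel s r by move: rH; rewrite inE => /and3P[].
  case/asboolP=> w [w0 ls wr]; exists (s :: w); first by rewrite block_word w0 ls eqxx.
  have cls a b : part_class U a = part_class U b -> orbit_eq H a b.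
    by move=> ?; apply/(orbit_class_eqP HM).
  split=> //; rewrite ?block_type_word ?wr.
  - by move=> a b aD bD /(pi_part _ _ aD bD)/(orbit_class_eqP HM).
  - move=> a b ab; rewrite /= (class_leE HM); exact: orbit_leI ab.
  (* Were [a] and [b] in one class of [part], either [b] would be [a] or the group would lead back
     from [b] to [a]; both give a loop at [a]. *)
  - move=> a b; rewrite inE => /negP aD ab /cls /andP[_ /orP[/eqP ba|]].
      by apply: aD; apply: (relation_loop He rH); rewrite ba in ab.
    case/exists_inP=> t tH ba; apply: aD; apply: (relation_loop He (HM _ _ rH tH)).
    exact: rcompI ba.
  - by move=> a b aD bD ab /cls; apply: pi_act.
have [pi1 pi1G _] := GammaH _ eH.
have [A] : exists A, A \in 'Fix_(nabla_classes U | 'P)(Gamma s U)%g.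
  apply/set0Pn/negP => /eqP Fix0; apply: nmix; exists s, U; split=> //.
  by apply/set0Pn; exists pi1.
rewrite inE => /andP[/imsetP[a aD AE] /afixP Afix].
exists a => r rH; have [pi piG] := GammaH _ rH.
case/(_ a aD) => b ab [bD piab].
have /(loop_class_eqP eH HM e_id bD aD)/andP[ba _] : nabla_class U b = nabla_class U a.
  by rewrite -piab; move: (Afix _ piG); rewrite AE.
by have [_ <-] := e_id _ rH; apply: rcompI ba.
Qed.

End Words.

(** Otherwise each value fails from some time on, and at the largest of these times none is left. *)
Lemma finite_konig (V : finType) (P : nat -> V -> Prop) :
  (forall n a, P n.+1 a -> P n a) -> (forall n, exists a, P n a) ->
  exists a, forall n, P n a.
Proof.
move=> PS Pex; apply: contrapT => nP.
have /choice[N HN] : forall a, exists n, ~ P n a.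
  move=> a; apply: contrapT => Ha; apply: nP; exists a => n.
  by apply: contrapT => Hn; apply: Ha; exists n.
have Pmono m n a : m <= n -> P n a -> P m a.
  by move=> /subnK <-; elim: (n - m) => //= k IH /PS.
have [a Pa] := Pex (\max_a N a); apply: (HN a).
by apply: Pmono Pa; apply: leq_bigmax.
Qed.

(** * Borel predicates and labelings *)

Section BorelPredicates.
Variables (X : Type) (B : classical_sets.set (classical_sets.set X)).
Hypotheses (BC : forall P : X -> Prop, B P -> B (fun x => ~ P x))
  (BE : forall P : nat -> X -> Prop, (forall n, B (P n)) -> B (fun x => exists n, P n x))
  (BF : B (fun=> False)).
Implicit Types P Q : X -> Prop.

Lemma borel_ext P Q : (forall x, P x <-> Q x) -> B P -> B Q.
Proof. by move=> E; have -> : Q = P by apply/funext => x; apply/propext; split=> /E. Qed.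

Lemma borel_cst (p : Prop) : B (fun=> p).
Proof.
case: (pselect p) => hp; last by apply: borel_ext BF => x.
by apply: borel_ext (BC BF) => x; split=> // _ [].
Qed.

Lemma borel_ex (K : countType) (P : K -> X -> Prop) :
  (forall k, B (P k)) -> B (fun x => exists k, P k x).
Proof.
move=> BP; apply: (@borel_ext (fun x =>
    exists n, if unpickle n is Some k then P k x else False)).
  move=> x; split=> [[n]|[k Pk]]; last by exists (pickle k); rewrite pickleK.
  by case: unpickle => // k Pk; exists k.
by apply: BE => n; case: unpickle.
Qed.

Lemma borel_all (K : countType) (P : K -> X -> Prop) :
  (forall k, B (P k)) -> B (fun x => forall k, P k x).
Proof.
move=> BP; apply: borel_ext (BC (borel_ex (fun k => BC (BP k)))) => x.
split=> [nP k|HP [k]]; last exact.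
by apply: contrapT => Pk; apply: nP; exists k.
Qed.

Lemma borel_or P Q : B P -> B Q -> B (fun x => P x \/ Q x).
Proof.
move=> BP BQ; apply: (@borel_ext (fun x => exists b : bool, if b then P x else Q x)).
  by move=> x; split=> [[[]]|[]] ?; [left|right|exists true|exists false].
by apply: borel_ex => -[].
Qed.

Lemma borel_and P Q : B P -> B Q -> B (fun x => P x /\ Q x).
Proof.
move=> BP BQ; apply: (@borel_ext (fun x => forall b : bool, if b then P x else Q x)).
  by move=> x; split=> [H|[H1 H2] []//]; split; [apply: (H true)|apply: (H false)].
by apply: borel_all => -[].
Qed.

Lemma borel_impl P Q : B P -> B Q -> B (fun x => P x -> Q x).
Proof.
move=> BP BQ; apply: borel_ext (borel_or (BC BP) BQ) => x.
by split=> [[]//|PQ]; case: (pselect (P x)) => [/PQ|]; [right|left].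
Qed.

(** Measurability is tested on fibres, which is enough for countable ranges. *)
Definition borel_fun (L : Type) (f : X -> L) : Prop :=
  forall c, B (fun x => f x = c).

Lemma borel_funP (L : countType) (f : X -> L) (P : L -> Prop) :
  borel_fun f -> B (fun x => P (f x)).
Proof.
move=> Bf; apply: (@borel_ext (fun x => exists c, f x = c /\ P c)).
  by move=> x; split=> [[c [-> //]]|Pf]; exists (f x).
by apply: borel_ex => c; apply: borel_and => //; apply: borel_cst.
Qed.

Lemma borel_fun2 (L M : countType) (N : Type) (f : X -> L) (g : X -> M)
    (h : L -> M -> N) :
  borel_fun f -> borel_fun g -> borel_fun (fun x => h (f x) (g x)).
Proof.
move=> Bf Bg c; apply: (@borel_funP _ (fun x => (f x, g x)) (fun p => h p.1 p.2 = c)).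
move=> [a b]; apply: borel_ext (borel_and (Bf a) (Bg b)) => x.
by split=> [[-> ->]|[]].
Qed.

Section Selection.
Variables (V : finType) (v0 : V) (P : X -> V -> Prop).

Definition select (x : X) : V := odflt v0 [pick a | `[< P x a >]].

Lemma selectP x : (exists a, P x a) -> P x (select x).
Proof.
move=> [a Pa]; rewrite /select; case: pickP => [b /asboolP //|/(_ a)].
by move/asboolP: Pa => ->.
Qed.

(** The selected value depends only on the set of admissible values, which is a Borel function into
    a finite type. *)
Lemma borel_select : (forall a, B (fun x => P x a)) -> borel_fun select.
Proof.
move=> BP c; pose u x := [ffun a => `[< P x a >]].
have Bu : borel_fun u.
  move=> w; apply: (@borel_ext (fun x => forall a, P x a <-> w a)).
    move=> x; split=> [xw|<- a]; last by rewrite ffunE; split=> /asboolP.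
    apply/ffunP=> a; rewrite ffunE; apply/asboolP/idP; by case: (xw a).
  apply: borel_all => a; apply: borel_ext (borel_and (borel_impl (BP a) (borel_cst (w a)))
    (borel_impl (borel_cst (w a)) (BP a))) => x.
  by split=> -[].
pose pick_in (v : {ffun V -> bool}) := odflt v0 [pick a | v a].
apply: borel_ext (borel_funP (fun v => pick_in v = c) Bu) => x.
rewrite /select /pick_in /u (eq_pick (Q := fun a => `[< P x a >])) // => a.
by rewrite ffunE.
Qed.

End Selection.

(** Use at [x] the solution of the least index whose piece contains [x]; as the pieces are
    invariant, [S x] has the same index. *)
Lemma borel_glue (V : finType) (v0 : V) (S : X -> X) (E : X -> V -> V -> Prop)
    (Y : nat -> X -> Prop) :
  (forall k, B (Y k)) -> (forall k x, Y k (S x) <-> Y k x) ->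
  (forall k, exists f, borel_fun f /\ forall x, Y k x -> E x (f x) (f (S x))) ->
  exists f, borel_fun f /\ forall x, (exists k, Y k x) -> E x (f x) (f (S x)).
Proof.
move=> BY YS /choice[f Hf].
pose least x k := Y k x /\ forall j, j < k -> ~ Y j x.
have leastS x k : least (S x) k <-> least x k.
  by split=> -[/YS Yk Hk]; split=> // j jk /YS; apply: Hk.
have least_ex x : (exists k, Y k x) -> exists k, least x k by apply: least_nat.
have least_uniq x k l : least x k -> least x l -> k = l.
  move=> [Yk Hk] [Yl Hl]; case: (ltngtP k l) => // [/Hl|/Hk] //.
pose F := select v0 (fun x c => exists k, least x k /\ f k x = c).
have FE x k : least x k -> F x = f k x.
  move=> lk; rewrite /F; set Q := (Q in select _ Q).
  have [|l [ll <-]] := selectP v0 (P := Q) (x := x); first by exists (f k x), k.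
  by rewrite (least_uniq x k l).
exists F; split.
  apply: borel_select => c; apply: borel_ex => k; apply: borel_and; last by case: (Hf k).
  apply: borel_and => //; apply: borel_all => j.
  by apply: borel_impl; [apply: borel_cst|apply: BC].
move=> x /least_ex[k lk]; rewrite (FE _ _ lk) (FE (S x) k); last exact/leastS.
by have [_] := Hf k; apply; case: lk.
Qed.

(** * Propagating labels along orbits from a Borel set of starting points *)

Section Extension.
Variables (S T : X -> X).
Hypotheses (TS : cancel T S) (ST : cancel S T).
Hypotheses (BS : forall P, B P -> B (fun x => P (S x)))
  (BT : forall P, B P -> B (fun x => P (T x))).

Lemma borel_iter n P (F : X -> X) : (forall P, B P -> B (fun x => P (F x))) ->
  B P -> B (fun x => P (iter n F x)).
Proof.
move=> BFP BP; elim: n => //= n /BFP IH.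
by apply: borel_ext IH => x; rewrite -iterSr.
Qed.

Lemma iter_cancel n : cancel (iter n T) (iter n S).
Proof. by elim: n => // n IH x; rewrite iterSr iterS TS IH. Qed.

Variables (V : finType) (v0 : V) (E : X -> V -> V -> Prop) (G : X -> V -> Prop)
  (C Y : X -> Prop) (g : X -> V).
Hypotheses (BEd : forall a b, B (fun x => E x a b)) (BG : forall a, B (fun x => G x a))
  (BCo : B C) (Bg : borel_fun g).
Hypotheses (YS : forall x, Y x -> Y (S x)) (YT : forall x, Y x -> Y (T x)).
Hypotheses (GS : forall x a, Y x -> G x a -> exists b, E x a b /\ G (S x) b)
  (Gg : forall x, Y x -> C x -> G x (g x)).

Let next b := select v0 (fun x c => E x b c /\ G (S x) c).

Let Fixpoint walk n x := if n is n'.+1 then next (walk n' x) (iter n' S x) else g x.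

Let nextP x b : Y x -> G x b -> E x b (next b x) /\ G (S x) (next b x).
Proof.
move=> Yx Gx.
exact: (selectP v0 (P := fun x c => E x b c /\ G (S x) c) (GS Yx Gx)).
Qed.

(** First going backwards: [n] is the time elapsed since the most recent visit to [C]. *)
Let first x n := C (iter n T x) /\ forall m, m < n -> ~ C (iter m T x).

Let first_uniq x n m : first x n -> first x m -> n = m.
Proof.
by move=> [Cn Hn] [Cm Hm]; case: (ltngtP n m) => // [/Hm|/Hn] //.
Qed.

Let first_ex x : (exists n, C (iter n T x)) -> exists n, first x n.
Proof. exact: least_nat. Qed.

Let borel_first n : B (fun x => first x n).
Proof.
apply: borel_and; first exact: borel_iter.
apply: borel_all => m; apply: borel_impl; first exact: borel_cst.
by apply: BC; apply: borel_iter.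
Qed.

Let borel_walk n : borel_fun (walk n).
Proof.
elim: n => //= n IH c.
apply: (@borel_ext (fun x => exists b, walk n x = b /\ next b (iter n S x) = c)).
  by move=> x; split=> [[b [<-]]|] //; exists (walk n x).
apply: borel_ex => b; apply: borel_and => //.
apply: (@borel_iter n (fun x => next b x = c)) => //.
by apply: borel_select => d; apply: borel_and => //; apply: BS (BG d).
Qed.

Let walkG n x : Y x -> C x -> Y (iter n S x) /\ G (iter n S x) (walk n x).
Proof.
move=> Yx Cx; elim: n => [|n [IHY IHG]] /=; first by split; auto.
split; first exact: YS.
by case: (nextP IHY IHG).
Qed.

Let walkE n x : Y x -> C x -> E (iter n S x) (walk n x) (walk n.+1 x).
Proof.
move=> Yx Cx; have [Yn Gn] := walkG n Yx Cx.
by case: (nextP Yn Gn).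
Qed.

(** The value at [x] is obtained by walking from the most recent visit to [C], starting there with
    [g]; the invariant [G] guarantees a next value. Entering [C] resets the walk, so the edge into a
    point of [C] is left to the user of the lemma. *)
Lemma borel_extension : exists f, [/\ borel_fun f, forall x, C x -> f x = g x &
  forall x, Y x -> (exists n, C (iter n T x)) ->
    G x (f x) /\ (~ C (S x) -> E x (f x) (f (S x)))].
Proof.
have Yiter n x : Y x -> Y (iter n T x) by move=> Yx; elim: n => //= n; apply: YT.
pose Q x c := exists n, first x n /\ walk n (iter n T x) = c.
have fE x n : first x n -> select v0 Q x = walk n (iter n T x).
  move=> xn; have [|m [xm <-]] := selectP v0 (P := Q) (x := x).
    by exists (walk n (iter n T x)), n.
  by rewrite (first_uniq xn xm).
exists (select v0 Q); split.
- apply: borel_select => c; apply: borel_ex => n; apply: borel_and => //.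
  by apply: (@borel_iter n (fun x => walk n x = c)) => //; apply: borel_walk.
- by move=> x Cx; rewrite (fE x 0).
move=> x Yx /first_ex[n xn]; have [Cn Hn] := xn.
have [_] := walkG n (Yiter n _ Yx) Cn; rewrite iter_cancel (fE _ _ xn) => Gx.
split=> // nC; rewrite (fE (S x) n.+1); last first.
  split; first by rewrite iterSr ST.
  by case=> // m; rewrite ltnS iterSr ST; apply: Hn.
have := walkE n (Yiter n _ Yx) Cn.
by rewrite iterSr ST iter_cancel.
Qed.

End Extension.

(** * Borel solutions of edge constraints along orbits *)

Section Dynamics.
Variables (S T : X -> X).
Hypotheses (TS : cancel T S) (ST : cancel S T).
Hypotheses (BS : forall P, B P -> B (fun x => P (S x)))
  (BT : forall P, B P -> B (fun x => P (T x))).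
Variables (V : finType) (v0 : V) (E : X -> {set V * V}).
Hypothesis BEd : borel_fun E.

Fixpoint orbit_rel n x : {set V * V} :=
  if n is n'.+1 then rcomp (E x) (orbit_rel n' (S x)) else rid V.

Lemma orbit_rel_add n m x :
  orbit_rel (n + m) x = rcomp (orbit_rel n x) (orbit_rel m (iter n S x)).
Proof.
elim: n x => [|n IH] x; first by rewrite rcomp0x.
by rewrite addSn /= IH rcompA -iterSr.
Qed.

Lemma orbit_relSr n x : orbit_rel n.+1 x = rcomp (orbit_rel n x) (E (iter n S x)).
Proof. by rewrite -addn1 orbit_rel_add /= rcompx0. Qed.

Lemma borel_edge a b : B (fun x => (a, b) \in E x).
Proof. exact: (borel_funP (fun r : {set V * V} => (a, b) \in r)). Qed.

Lemma borel_orbit_rel n : borel_fun (orbit_rel n).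
Proof.
elim: n => [|n IH] /=; first by move=> c; apply: borel_cst.
apply: (@borel_fun2 _ _ _ E (fun x => orbit_rel n (S x)) (@rcomp V)) => //.
by move=> c; apply: BS (IH c).
Qed.

Lemma borel_orbit_rel_in n a b : B (fun x => (a, b) \in orbit_rel n x).
Proof.
exact: (borel_funP (fun r : {set V * V} => (a, b) \in r) (borel_orbit_rel n)).
Qed.

Lemma borel_iterS n P : B P -> B (fun x => P (iter n S x)).
Proof. exact: borel_iter. Qed.

Lemma borel_iterT n P : B P -> B (fun x => P (iter n T x)).
Proof. exact: borel_iter. Qed.

Definition solvable (Y : X -> Prop) :=
  exists f, borel_fun f /\ forall x, Y x -> (f x, f (S x)) \in E x.

(** Any two points of an orbit are joined by such a composite of iterates, without integer
    exponents. *)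
Definition orbit_meets (C : X -> Prop) x := exists n m, C (iter m T (iter n S x)).

Lemma orbit_meets_sub C : forall x, C x -> orbit_meets C x.
Proof. by move=> x Cx; exists 0, 0. Qed.

Lemma borel_orbit_meets C : B C -> B (orbit_meets C).
Proof.
move=> BCo; apply: borel_ex => n; apply: borel_ex => m.
exact: borel_iterS (borel_iterT _ BCo).
Qed.

Lemma orbit_meetsS C x : orbit_meets C (S x) <-> orbit_meets C x.
Proof.
split=> -[n [m Cx]]; first by exists n.+1, m; rewrite iterSr.
by exists n, m.+1; rewrite -iterSr [iter n.+1 _ _]iterS [iter m.+1 _ _]iterSr ST.
Qed.

Lemma iterTS n m x : n <= m -> iter m T (iter n S x) = iter (m - n) T x.
Proof. by move=> nm; rewrite -{1}(subnK nm) iterD (iter_cancel ST). Qed.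

Lemma iterST n m x : m <= n -> iter m T (iter n S x) = iter (n - m) S x.
Proof. by move=> mn; rewrite -{1}(subnKC mn) iterD (iter_cancel ST). Qed.

Lemma orbit_meets_split C x :
  orbit_meets C x <-> (exists n, C (iter n T x)) \/ (exists n, C (iter n S x)).
Proof.
split=> [[n [m]]|[[n Cn]|[n Cn]]]; last 2 first.
- by exists 0, n.
- by exists n, 0.
by case: (leqP n m) => [nm|/ltnW mn]; [rewrite iterTS|rewrite iterST] => // Cx;
  [left; exists (m - n)|right; exists (n - m)].
Qed.

(** All points of [C] get the label [a]. In between, the invariant [G] says that the current label
    can still reach [a] at the next visit to [C]. *)
Lemma solvable_recurrent (C Y : X -> Prop) a : B C ->
  (forall x, Y x -> Y (S x)) -> (forall x, Y x -> Y (T x)) ->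
  (forall x, Y x -> exists n, C (iter n.+1 S x)) ->
  (forall x, Y x -> exists n, C (iter n T x)) ->
  (forall x n, Y x -> C x -> C (iter n.+1 S x) -> (a, a) \in orbit_rel n.+1 x) ->
  solvable Y.
Proof.
move=> BCo YS YT futC pastC CC.
pose next_at x m := C (iter m S x) /\ forall j, j < m -> ~ C (iter j S x).
pose G x b := exists m, next_at x m /\ (b, a) \in orbit_rel m x.
have next0 x m : C x -> next_at x m -> m = 0.
  by move=> Cx; case: m => // m [_ /(_ 0)] [].
have nextS x : Y x -> exists m, next_at (S x) m.
  by case/futC=> n Cn; apply: least_nat; exists n; rewrite -iterSr.
have BG b : B (fun x => G x b).
  apply: borel_ex => m; apply: borel_and; last exact: borel_orbit_rel_in.
  apply: borel_and; first exact: borel_iterS.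
  apply: borel_all => j; apply: borel_impl; first exact: borel_cst.
  by apply: BC; apply: borel_iterS.
have GS x b : Y x -> G x b -> exists c, (b, c) \in E x /\ G (S x) c.
  move=> Yx [m [xm bm]].
  have step k : next_at (S x) k -> (b, a) \in orbit_rel k.+1 x ->
      exists c, (b, c) \in E x /\ G (S x) c.
    by move=> Sk /rcompP[c bc ca]; exists c; split=> //; exists k.
  case: m xm bm => [|m] [Cm Hm] bm; last first.
    apply: (step m) => //; split; first by rewrite -iterSr.
    by move=> j jm; rewrite -iterSr; apply: Hm.
  (* At a point of [C] the label is [a], and the loop at [a] given by [CC] leads to the next
     visit. *)
  have [k Sk] := nextS x Yx; apply: (step k) => //.
  move: bm; rewrite inE => /eqP /= ->; apply: CC => //.
  by rewrite iterSr; case: Sk.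
have Gg x : Y x -> C x -> G x a.
  by move=> _ Cx; exists 0; split; [split|rewrite inE /=].
have [f [Bf fC Hf]] := borel_extension TS ST BS BT v0
  (E := fun x b c => (b, c) \in E x) borel_edge BG BCo
  (fun c => borel_cst (a = c)) YS YT GS Gg.
exists f; split=> // x Yx; have [Gx EC] := Hf x Yx (pastC x Yx).
(* If [S x] is in [C], the only value satisfying [G] there is [a], the value to which the extension
   is reset. *)
case: (pselect (C (S x))) => [CS|/EC //].
have [c [xc [m [Sm cm]]]] := GS x (f x) Yx Gx.
by move: cm; rewrite (next0 _ _ CS Sm) inE (fC _ CS) => /eqP /= <-.
Qed.

(** * Orbits with a Borel selector *)

Section Transversal.
Hypothesis E_ne : forall n x, orbit_rel n x != finset.set0.

(** The labels at [x] that extend to arbitrarily long finite stretches after [x], respectively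
    before it. *)
Let Gp x a := forall n, exists b, (a, b) \in orbit_rel n x.
Let Gm x a := forall n, exists b, (b, a) \in orbit_rel n (iter n T x).

Let iter_succ n x : iter n S (iter n.+1 T x) = T x.
Proof. by rewrite iterSr iter_cancel. Qed.

Let Gp_ex x : exists a, Gp x a /\ Gm x a.
Proof.
have [|n|a Pa] := @finite_konig V (fun n a => (exists b, (a, b) \in orbit_rel n x) /\
    (exists b, (b, a) \in orbit_rel n (iter n T x))).
- move=> n a [[b ab] [c ca]]; split.
    by move: ab; rewrite orbit_relSr => /rcompP[d ad _]; exists d.
  by move: ca; rewrite /= TS => /rcompP[d _ da]; exists d.
(* A labeling of the stretch of [n + n] edges centred at [x] gives a label at [x] that serves both
   directions. *)
- have /set0Pn[[b c]] := E_ne (n + n) (iter n T x).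
  rewrite orbit_rel_add iter_cancel // => /rcompP[a ba ac].
  by exists a; split; [exists c|exists b].
by exists a; split=> n; case: (Pa n).
Qed.

Let GpS x a : Gp x a -> exists b, (a, b) \in E x /\ Gp (S x) b.
Proof.
move=> Ga; have [|n|b Pb] := @finite_konig V (fun n b => (a, b) \in E x /\
    exists c, (b, c) \in orbit_rel n (S x)).
- move=> n b [ab [c bc]]; split=> //.
  by move: bc; rewrite orbit_relSr => /rcompP[d bd _]; exists d.
- by have [c /rcompP[b ab bc]] := Ga n.+1; exists b; split=> //; exists c.
by exists b; split=> [|n]; [case: (Pb 0)|case: (Pb n)].
Qed.

Let GmT x a : Gm x a -> exists b, (b, a) \in E (T x) /\ Gm (T x) b.
Proof.
move=> Ga; have [|n|b Pb] := @finite_konig V (fun n b => (b, a) \in E (T x) /\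
    exists c, (c, b) \in orbit_rel n (iter n T (T x))).
- move=> n b [ab [c bc]]; split=> //.
  by move: bc; rewrite /= TS => /rcompP[d _ db]; exists d.
- have [c] := Ga n.+1; rewrite orbit_relSr iter_succ => /rcompP[b cb ba].
  by exists b; split=> //; exists c; rewrite -iterSr.
by exists b; split=> [|n]; [case: (Pb 0)|case: (Pb n)].
Qed.

Let borel_Gp a : B (fun x => Gp x a).
Proof.
apply: borel_all => n; apply: borel_ex => b; exact: borel_orbit_rel_in.
Qed.

Let borel_Gm a : B (fun x => Gm x a).
Proof.
apply: borel_all => n; apply: borel_ex => b.
exact: (borel_iterT n (borel_orbit_rel_in n b a)).
Qed.

(* On the orbits with a Borel selector, a solution is built outwards from the
   selected point; Koenig's lemma keeps the partial solutions extendible. *)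
Lemma solvable_transversal (Z : X -> Prop) : B Z ->
  (forall x n, Z x -> ~ Z (iter n.+1 S x)) -> solvable (orbit_meets Z).
Proof.
move=> BZ Zuniq; pose g := select v0 (fun x a => Gp x a /\ Gm x a).
have Bg : borel_fun g by apply: borel_select => a; apply: borel_and.
have gP x : Gp x (g x) /\ Gm x (g x).
  exact: (selectP v0 (P := fun x a => Gp x a /\ Gm x a) (Gp_ex x)).
have [fp [Bfp fpZ fpE]] := borel_extension TS ST BS BT v0
  (E := fun x b c => (b, c) \in E x) borel_edge borel_Gp BZ Bg
  (Y := fun=> True) (fun _ _ => I) (fun _ _ => I) (fun x a _ => @GpS x a)
  (fun x _ _ => (gP x).1).
(* The same extension along [T], with the edges reversed, labels the points before the selected
   one. *)
have [fm [Bfm fmZ fmE]] := borel_extension ST TS BT BS v0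
  (E := fun x b c => (c, b) \in E (T x)) (fun a b => BT (borel_edge b a)) borel_Gm BZ Bg
  (Y := fun=> True) (fun _ _ => I) (fun _ _ => I) (fun x a _ => @GmT x a)
  (fun x _ _ => (gP x).2).
pose past x := exists n, Z (iter n T x).
have Bpast : B past by apply: borel_ex => n; apply: borel_iterT.
exists (fun x => if `[< past x >] then fp x else fm x); split.
  move=> c; apply: (@borel_ext (fun x => (past x -> fp x = c) /\ (~ past x -> fm x = c))).
    by move=> x; case: asboolP => px; split=> [[]|->]; auto.
  by apply: borel_and; apply: borel_impl => //; apply: BC.
move=> x /orbit_meets_split xZ; case: asboolP => px.
  have pS : past (S x) by case: px => n Zn; exists n.+1; rewrite iterSr ST.
  rewrite (introT (asboolP _) pS); have [_] := fpE x I px; apply=> ZS.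
  (* A point of [Z] at [S x] would be a second one on the orbit, after that found at or before
     [x]. *)
  case: px => n Zn; apply: (Zuniq _ n Zn).
  by rewrite iterS iter_cancel.
have [n Zn] : exists n, Z (iter n S (S x)).
  case: xZ => [//|[[Zx|n Zn]]]; first by case: px; exists 0.
  by exists n; rewrite -iterSr.
have nZx : ~ Z x.
  by move=> Zx; apply: px; exists 0.
have [_] := fmE (S x) I (ex_intro _ n Zn).
rewrite ST => /(_ nZx) Efm; case: asboolP => // -[[|k] Zk]; last first.
  by case: px; exists k; rewrite -[x]ST -iterSr.
(* Here [S x] is the selected point, where the two labelings agree with [g]. *)
by rewrite fpZ // -fmZ.
Qed.

End Transversal.
End Dynamics.

End BorelPredicates.

(** * Markers *)

(** A term of least cardinality contains all later ones, so these equal it. *)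
Lemma decreasing_sets_stable (K : finType) (F : nat -> {set K}) :
  (forall n, F n.+1 \subset F n) -> exists N, forall n, N <= n -> F n = F N.
Proof.
move=> FS; have Fmono m n : m <= n -> F n \subset F m.
  by move=> /subnK <-; elim: (n - m) => //= k; apply: fintype.subset_trans; apply: FS.
have [|k [[N FN] mink]] := @least_nat (fun k => exists n, #|F n| = k).
  by exists #|F 0|, 0.
exists N => n Nn; apply/eqP; rewrite eqEcard Fmono // FN leqNgt.
by apply/negP => /mink; apply; exists n.
Qed.

(** * Last visits to a set, and first visits by exchanging [S] and [T] *)

Section LastVisit.
Variables (X : Type) (S T : X -> X).
Hypothesis TS : cancel T S.

Definition last_visit (C : X -> Prop) x := C x /\ forall n, ~ C (iter n.+1 S x).

(** Without a later visit, the most recent one would be the last. *)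
Lemma later_visit C x :
  (exists n, C (iter n T x)) \/ (exists n, C (iter n S x)) ->
  ~ (exists n, last_visit C (iter n T x)) -> exists n, C (iter n.+1 S x).
Proof.
move=> visit nlast; apply: contrapT => nfut.
have nS n : ~ C (iter n.+1 S x) by move=> Cn; apply: nfut; exists n.
have [m [Cm minm]] : exists m, C (iter m T x) /\ forall j, j < m -> ~ C (iter j T x).
  apply: least_nat; case: visit => // -[[|n] Cn]; first by exists 0.
  by case: (nS n).
apply: nlast; exists m; split=> // j; case: (leqP j.+1 m) => jm.
  rewrite (iterST TS) //; apply: minm.
  by rewrite ltn_subrL (leq_trans _ jm).
by rewrite (iterTS TS) ?(ltnW jm) // subSn //; apply: nS.
Qed.

End LastVisit.

Section Markers.
Variables (Pi : lcl) (X : Type) (B : classical_sets.set (classical_sets.set X)).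
Hypotheses (BC : forall P : X -> Prop, B P -> B (fun x => ~ P x))
  (BE : forall P : nat -> X -> Prop, (forall n, B (P n)) -> B (fun x => exists n, P n x))
  (BF : B (fun=> False)).
Variables (S T : X -> X).
Hypotheses (TS : cancel T S) (ST : cancel S T).
Hypotheses (BS : forall P, B P -> B (fun x => P (S x)))
  (BT : forall P, B P -> B (fun x => P (T x))).
Variables (i : X -> Sigma_in Pi) (v0 : Sigma_out Pi).
Hypothesis Bi : borel_fun B i.
Hypothesis nmix : ~ mixing Pi.
Variable W : nat -> X -> Prop.
Hypotheses (BW : forall j, B (W j))
  (Wsep : forall x y, x <> y -> exists j, W j x /\ ~ W j y).
Hypothesis aper : aperiodic S.

Let E x := edge_rel (i x) (i (S x)).
Let orel := orbit_rel S E.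
Let rI := right_ideal (@rcomp (Sigma_out Pi)).
Let lI := left_ideal (@rcomp (Sigma_out Pi)).

Let BEd : borel_fun B E.
Proof.
apply: (@borel_fun2 X B BC BE BF _ _ _ i (fun x => i (S x)) (@edge_rel Pi)) => //.
by move=> c; apply: BS (Bi c).
Qed.

Lemma orbit_rel_word n x : orel n x = word_rel (i x) (map i (traject S (S x) n)).
Proof. by elim: n x => //= n IH x; rewrite /orel /= -IH. Qed.

(* [N] is a time from which the types of the words starting, respectively
   ending, at [x] have stable right, respectively left, ideal. The sets [W j],
   [j \in js], keep two markers at distance at least [N]. *)
Definition marker
    (c : Sigma_in Pi * {set {set Sigma_out Pi * Sigma_out Pi}} *
         {set {set Sigma_out Pi * Sigma_out Pi}} * nat * seq nat) x :=
  let: (s, rho, lam, N, js) := c in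
  [/\ i x = s, forall n, N <= n -> rI (orel n x) = rho,
      forall n, N <= n -> lI (orel n (iter n T x)) = lam,
      forall j, j \in js -> W j x &
      forall n, n.+1 < N -> ~ forall j, j \in js -> W j (iter n.+1 S x)].

Lemma borel_marker c : B (marker c).
Proof.
move: c => [[[[s rho] lam] N] js].
have cst := borel_cst BC BF; have imp := borel_impl BC BE BF.
have Borel n := borel_orbit_rel BC BE BF BS BEd n.
have BWjs : B (fun x => forall j, j \in js -> W j x).
  by apply: (borel_all BC BE BF) => j; apply: imp.
apply: (@borel_ext _ _ (fun x => i x = s /\ ((forall n, N <= n -> rI (orel n x) = rho) /\
    ((forall n, N <= n -> lI (orel n (iter n T x)) = lam) /\
    ((forall j, j \in js -> W j x) /\
      (forall n, n.+1 < N -> ~ forall j, j \in js -> W j (iter n.+1 S x))))))).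
  by move=> x; split=> [[? [? [? []]]]|[]].
apply: (borel_and BC BE BF); first exact: Bi.
apply: (borel_and BC BE BF).
  apply: (borel_all BC BE BF) => n; apply: imp; first exact: cst.
  exact: (borel_funP BC BE BF (fun r => rI r = rho) (Borel n)).
apply: (borel_and BC BE BF).
  apply: (borel_all BC BE BF) => n; apply: imp; first exact: cst.
  apply: (borel_iterT BT n (P := fun x => lI (orel n x) = lam)).
  exact: (borel_funP BC BE BF (fun r => lI r = lam) (Borel n)).
apply: (borel_and BC BE BF) => //.
apply: (borel_all BC BE BF) => n; apply: imp; first exact: cst.
by apply: BC; apply: (borel_iterS BS n.+1 BWjs).
Qed.

Lemma marker_ex x : exists c, marker c x.
Proof.
have [n|N1 H1] := @decreasing_sets_stable _ (fun n => rI (orel n x)).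
  by rewrite /orel orbit_relSr; apply: right_idealS (@rcompA _) _ _.
have [n|N2 H2] := @decreasing_sets_stable _ (fun n => lI (orel n (iter n T x))).
  by rewrite /orel /= TS; apply: left_idealS (@rcompA _) _ _.
(* By aperiodicity [x] differs from its iterates, so some [W j] separates it from each; the
   separators for times up to [N] form [js]. *)
have /choice[sep Hsep] : forall n, exists j, W j x /\ ~ W j (iter n.+1 S x).
  by move=> n; apply: Wsep => /esym /aper.
pose N := maxn N1 N2.
exists (i x, rI (orel N1 x), lI (orel N2 (iter N2 T x)), N, map sep (iota 0 N)).
split=> // [n|n|j /mapP[n _ ->]|n nN /(_ (sep n))].
- by rewrite geq_max => /andP[? _]; apply: H1.
- by rewrite geq_max => /andP[_ ?]; apply: H2.
- by case: (Hsep n).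
rewrite map_f ?mem_iota ?(ltnW nN) // => /(_ isT).
by case: (Hsep n).
Qed.

(** The return time is at least [N], so the right ideal is already stable as seen from the first
    marker, and the left ideal as seen from the second. *)
Lemma marker_green s rho lam N js x n :
  marker (s, rho, lam, N, js) x -> marker (s, rho, lam, N, js) (iter n.+1 S x) ->
  orel n.+1 x \in green_class (@rcomp _) (block_rel s) rho lam.
Proof.
move=> [ix rx _ _ Sx] [iS _ lS WS _].
have Nn : N <= n.+1 by rewrite leqNgt; apply/negP => /Sx; apply.
rewrite inE; apply/and3P; split; last 2 first.
- by apply/eqP; apply: rx.
- by apply/eqP; have := lS _ Nn; rewrite (iter_cancel ST).
apply/asboolP; exists (map i (traject S (S x) n.+1)).
split; first by rewrite size_map size_traject.
  by rewrite /= last_map last_traject -iterSr.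
by rewrite orbit_rel_word ix.
Qed.

(** Without first and last visits, the markers recur in both directions on the orbit. *)
Lemma solvable_marker c : solvable B S E (fun x => orbit_meets S T (marker c) x /\
  (~ orbit_meets S T (last_visit S (marker c)) x /\
   ~ orbit_meets S T (last_visit T (marker c)) x)).
Proof.
case: c => [[[[s rho] lam] N] js]; set C := marker _.
set Y := (Y in solvable _ _ _ Y).
have meetsT D x : orbit_meets S T D (T x) <-> orbit_meets S T D x.
  by rewrite -(orbit_meetsS ST) TS.
have YS x : Y x -> Y (S x) by rewrite /Y !(orbit_meetsS ST).
have YT x : Y x -> Y (T x) by rewrite /Y !meetsT.
have split_meets := orbit_meets_split ST.
have fut x : Y x -> exists n, C (iter n.+1 S x).
  move=> [/split_meets xC [nl _]]; apply: (later_visit TS xC) => -[n Cn].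
  by apply: nl; apply/split_meets; left; exists n.
have past x : Y x -> exists n, C (iter n T x).
  move=> [/split_meets /or_comm xC [_ nl]].
  have [[n Cn]|n Cn] := later_visit ST xC; last by exists n.+1.
  by apply: nl; apply/split_meets; right; exists n.
case: (pselect (exists x, Y x)) => [[x0 Yx0]|nY]; last first.
  exists (fun=> v0); split; first by move=> a; apply: borel_cst.
  by move=> x Yx; case: nY; exists x.
(* Three visits on one orbit supply two elements of the Green class whose product is again in it. *)
have [n0 C0] := fut _ Yx0; have Y0 : Y (iter n0.+1 S x0).
  by elim: n0.+1 => //= n; apply: YS.
have [n1 C1] := fut _ Y0; have Y1 : Y (iter n1.+1 S (iter n0.+1 S x0)).
  by elim: n1.+1 => //= n; apply: YS.
have [n2 C2] := fut _ Y1.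
have BCo : B C by apply: borel_marker.
have h1 := marker_green C0 C1; have h2 := marker_green C1 C2.
have h12 : orel (n1.+1 + n2.+1) (iter n0.+1 S x0)
    \in green_class (@rcomp _) (block_rel s) rho lam.
  by rewrite addnS; apply: (marker_green C0); rewrite -addnS addnC iterD.
rewrite /orel orbit_rel_add in h12.
have [a Ha] := nonmixing_common_loop nmix h1 h2 h12.
apply: (solvable_recurrent BC BE BF TS ST BS BT v0 BEd BCo YS YT fut past).
by move=> x n Yx Cx CSx; apply: Ha; exact: (marker_green Cx CSx).
Qed.

Lemma nonmixing_solvable : solvable B S E (fun=> True).
Proof.
have E_ne n x : orbit_rel S E n x != finset.set0.
  by rewrite -/orel orbit_rel_word word_rel_neq0.
(* The tag tells orbits with a last visit, with a first visit, and with neither. *)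
pose Ypiece (p : _ * option bool) x := let: (c, k) := p in
  match k with
  | Some true => orbit_meets S T (last_visit S (marker c)) x
  | Some false => orbit_meets S T (last_visit T (marker c)) x
  | None => orbit_meets S T (marker c) x /\
      (~ orbit_meets S T (last_visit S (marker c)) x /\
       ~ orbit_meets S T (last_visit T (marker c)) x)
  end.
pose Y n x := if unpickle n is Some p then Ypiece p x else False.
have BLS c : B (last_visit S (marker c)).
  apply: (borel_and BC BE BF); first exact: borel_marker.
  apply: (borel_all BC BE BF) => n; apply: BC.
  exact: (borel_iterS BS n.+1 (borel_marker c)).
have BLT c : B (last_visit T (marker c)).
  apply: (borel_and BC BE BF); first exact: borel_marker.
  apply: (borel_all BC BE BF) => n; apply: BC.
  exact: (borel_iterT BT n.+1 (borel_marker c)).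
have Bmeets := borel_orbit_meets BE BF BS BT.
have BY n : B (Y n).
  rewrite /Y; case: unpickle => // -[c [[]|]] /=; try exact: Bmeets.
  apply: (borel_and BC BE BF); first exact/Bmeets/borel_marker.
  by apply: (borel_and BC BE BF); apply: BC; apply: Bmeets.
have YS n x : Y n (S x) <-> Y n x.
  by rewrite /Y; case: unpickle => // -[c [[]|]] /=; rewrite !(orbit_meetsS ST).
have SY k : solvable B S E (Y k).
  rewrite /Y; case: unpickle => [[c [[]|]]|] /=; last 2 first.
  - exact: solvable_marker.
  - by exists (fun=> v0); split=> // a; apply: borel_cst.
  - apply: (solvable_transversal BC BE BF TS ST BS BT v0 BEd E_ne (BLS c)).
    by move=> x n [_ nC] [Cn _]; apply: (nC n).
  apply: (solvable_transversal BC BE BF TS ST BS BT v0 BEd E_ne (BLT c)).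
  by move=> x n [Cx _] [_ /(_ n)]; rewrite (iter_cancel ST).
have [f [Bf Hf]] := borel_glue BC BE BF v0 (E := fun x a b => (a, b) \in E x) BY YS SY.
exists f; split=> // x _; apply: Hf.
have [c cx] := marker_ex x.
have meet_c : orbit_meets S T (marker c) x by apply: orbit_meets_sub.
case: (pselect (orbit_meets S T (last_visit S (marker c)) x)) => [l1|nl1].
  by exists (pickle (c, Some true)); rewrite /Y pickleK.
case: (pselect (orbit_meets S T (last_visit T (marker c)) x)) => [l2|nl2].
  by exists (pickle (c, Some false)); rewrite /Y pickleK.
by exists (pickle (c, None : option bool)); rewrite /Y pickleK.
Qed.

End Markers.

(** * Standard Borel spaces *)

Section Separation.
Local Open Scope classical_set_scope.

(** Interiors of balls with centres in [D] and radii [1/(k+1)] separate points. *)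
Lemma metric_separating_opens (R : realType) (Y : metricType R) (D : set Y) :
  countable D -> dense D -> exists W : nat -> set Y,
    (forall j, open (W j)) /\ forall x y, x <> y -> exists j, W j x /\ ~ W j y.
Proof.
move=> /countable_injP[phi phi_inj] Ddense.
(* As [phi] is injective on [D], this union has at most one member. *)
pose Wp m k := \bigcup_(d in [set d | D d /\ phi d = m]) (ball d (k.+1%:R^-1 : R)%R)°.
pose W j := if unpickle j is Some (m, k) then Wp m k else classical_sets.set0.
exists W; rewrite /W; split.
  move=> j; case: unpickle => [[m k]|]; last exact: open0.
  by apply: bigcup_open => d _; exact: open_interior.
move=> x y xy; have dxy : (0 < mdist x y :> R)%R by rewrite mdist_gt0; apply/eqP.
(* With [r] below half the distance and a centre within [r / 2] of [x], the ball of radius [r]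
   contains a neighbourhood of [x] and misses [y]. *)
have [k Hk] : exists k, (k.+1%:R^-1 < mdist x y / 2 :> R)%R.
  by have [k] := ltr_add_invr (divr_gt0 dxy (ltr0n R 2)); rewrite add0r; exists k.
set r : R := (k.+1%:R^-1)%R in Hk.
have r0 : (0 < r)%R by rewrite invr_gt0 ltr0n.
have r20 : (0 < r / 2)%R by rewrite divr_gt0.
have [d [dx Dd]] : (ball x (r / 2))° `&` D !=set0.
  apply: Ddense; last exact: open_interior.
  exists x; rewrite /interior /=; exact: nbhsx_ballx.
have {}dx : ball x (r / 2)%R d := interior_subset dx.
exists (pickle (phi d, k)); rewrite pickleK; split.
  exists d => //; apply/nbhs_ballP; exists (r / 2)%R => //= z xz.
  by rewrite -/r [r]splitr; apply: ball_triangle xz; apply: ball_sym.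
move=> [d' [Dd' E]] /interior_subset.
rewrite (phi_inj _ _ (mem_set Dd') (mem_set Dd) E) -/r => dy.
have : ball x (r / 2 + r)%R y by apply: ball_triangle dy.
rewrite ballEmdist /=; apply/negP; rewrite -leNgt.
rewrite [leRHS](splitr (mdist x y)); apply: lerD; last exact: ltW.
by apply: le_trans (ltW Hk); rewrite ler_pdivrMr // ler_peMr ?(ltW r0) // ler1n.
Qed.

End Separation.

Theorem mainTheorem2 (R : realType) (Pi : lcl) : ~ mixing Pi -> BOREL R Pi.
Proof.
move=> nmix X B [Y [[_ [D Dcount Ddense]] [h [k hK kK] hB]]] S.
move=> [T [ST TS BS BT]] aper i Bi.
(* Transport along the isomorphism [h] turns [B] into the Borel sets of [Y], whence its closure
   properties. *)
have BP (P : X -> Prop) : B P <-> (<<s open >>)%classic (fun y => P (k y)).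
  by rewrite -hB; have -> : (h @^-1` (fun y => P (k y)))%classic = P by
    apply/funext => x; rewrite /= /preimage /mkset hK.
have BC (P : X -> Prop) : B P -> B (fun x => ~ P x).
  rewrite !BP => /sigma_algebraCD; congr ((<<s open >>)%classic _); apply/funext => y.
  by apply/propext; split=> [[]|].
have BE (P : nat -> X -> Prop) : (forall n, B (P n)) -> B (fun x => exists n, P n x).
  move=> HP; apply/BP.
  have := sigma_algebra_bigcup (fun n => (BP _).1 (HP n)).
  congr ((<<s open >>)%classic _); apply/funext => y.
  by apply/propext; split=> [[n _ Pn]|[n Pn]]; exists n.
have BF : B (fun=> False).
  by apply/BP; apply: sigma_algebra0.
have [W [Wopen Wsep]] := metric_separating_opens Dcount Ddense.
case: (pselect (exists x : X, True)) => [[x0 _]|nX]; last first.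
  exists (fun x => match nX (ex_intro _ x I) with end) => [A|x].
    by apply: (borel_ext _ BF) => x; case: nX; exists x.
  by case: nX; exists x.
(* A one-letter word has nonempty type, which provides a default output label. *)
have /set0Pn[[v0 _] _] := word_rel_neq0 (i x0) [::] nmix.
have Bi' : borel_fun B i by move=> s; apply: (Bi (fun t => t = s)).
have BW j : B (fun x => W j (h x)).
  by apply/(hB (W j)); apply: sub_sigma_algebra; apply: Wopen.
have WhS x y : x <> y -> exists j, W j (h x) /\ ~ W j (h y).
  by move=> xy; apply: Wsep => /(can_inj hK).
have [f [Bf Hf]] := nonmixing_solvable BC BE BF TS ST BS BT v0 Bi' nmix BW WhS aper.
exists f; first by move=> A; apply: (borel_funP BC BE BF (fun c => A c)).
by move=> x; have := Hf x I; rewrite inE.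
Qed.
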